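(* Let $G=(V,E)$ be a finite simple graph and let $v\in V$. Then \[ Q(G;x,y)=Q(G-v;x,y)+x(y-1)\,Q(G-N[v];x,y)+x\,Q(G/v;x,y). \]
   Context: All graphs are finite, simple and undirected. For a graph $G=(V,E)$ and $X\subseteq V$, $G[X]$ denotes the subgraph induced by $X$, and $k(H)$ denotes the number of connected components of a graph $H$, where the null graph (no vertices) has $k=0$. The subgraph component polynomial is $Q(G;x,y)=\sum_{X\subseteq V}x^{|X|}y^{k(G[X])}$. For $v\in V$: $G-v$ is obtained by removing $v$ and all edges incident to it; $N[v]$ is the closed neighbourhood of $v$ (its neighbours together with $v$), and $G-N[v]$ is obtained by removing all vertices of $N[v]$; $G/v$ (vertex contraction) is obtained from $G$ by removing $v$ and inserting an edge between every pair of non-adjacent neighbours of $v$. *)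

(* Defs.v *)
From mathcomp Require Import all_boot all_order all_algebra.
From mathcomp Require Import mpoly.
Set Implicit Arguments.
Unset Strict Implicit.
Unset Printing Implicit Defensive.
Import GRing.Theory.
Local Open Scope ring_scope.

Record sgraph := SGraph {
  svertex :> finType;
  sedge : rel svertex;
  sedge_sym : ssrbool.symmetric sedge;
  sedge_irrefl : irreflexive sedge
}.

(* n_comp counts connected components because the edge relation is symmetric;
   it is 0 on the graph without vertices. *)
Definition num_components (G : sgraph) : nat := n_comp (@sedge G) predT.

Section Operations.
Variable G : sgraph.

Section Induced.
Variable X : {set G}.

Definition induced_vertex : finType := {u : G | u \in X}.

Definition induced_edge : rel induced_vertex :=
  fun a b => sedge (val a) (val b).

Lemma induced_edge_sym : ssrbool.symmetric induced_edge.
Proof. by move=> a b; apply: sedge_sym. Qed.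

Lemma induced_edge_irrefl : irreflexive induced_edge.
Proof. by move=> a; apply: sedge_irrefl. Qed.

Definition induced : sgraph := SGraph induced_edge_sym induced_edge_irrefl.

End Induced.

Definition remove_vertices (S : {set G}) : sgraph := induced (~: S).

Definition remove_vertex (v : G) : sgraph := remove_vertices [set v].

Definition closed_nbhd (v : G) : {set G} := v |: [set u | sedge v u].

Section Contract.
Variable v : G.

Definition contract_edge : rel (remove_vertex v) :=
  fun a b => sedge a b ||
    [&& a != b, sedge v (val a) & sedge v (val b)].

Lemma contract_edge_sym : ssrbool.symmetric contract_edge.
Proof.
move=> a b; rewrite /contract_edge sedge_sym eq_sym.
by congr (_ || (_ && _)); apply: andbC.
Qed.

Lemma contract_edge_irrefl : irreflexive contract_edge.
Proof. by move=> a; rewrite /contract_edge sedge_irrefl eqxx. Qed.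

Definition contract_vertex : sgraph :=
  SGraph contract_edge_sym contract_edge_irrefl.

End Contract.

End Operations.

Definition xvar : {mpoly int[2]} := 'X_ord0.
Definition yvar : {mpoly int[2]} := 'X_ord_max.

Definition subgraph_component_poly (G : sgraph) : {mpoly int[2]} :=
  \sum_(X : {set G}) xvar ^+ #|X| * yvar ^+ num_components (induced X).

(* Main.v *)
Require Import Defs.
From mathcomp Require Import all_boot all_order all_algebra.
From mathcomp Require Import mpoly.
From mathcomp Require Import ring.
Import GRing.Theory.
Local Open Scope ring_scope.

(** Split the sum defining [Q(G)] according to whether [v] is in [X]; the sets
    [X] avoiding [v] give [Q(G - v)]. Write the others as [v |: Y]. If [Y] meets
    the neighbourhood of [v], then [G[v |: Y]] and [(G / v)[Y]] have the same
    number of components, as a path through [v] can be replaced by a new edge.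
    Otherwise [Y] avoids [N[v]], contraction adds no edge inside [Y], and [v]
    is one extra component, so that [y * y ^ k = (y - 1) * y ^ k + y ^ k]
    produces the correction term. *)

Section ComponentsWithin.

Set Implicit Arguments.
Unset Strict Implicit.

Variable T : finType.
Implicit Types (e f : rel T) (X Y : {set T}) (v : T).

(** Restricting the relation while staying on the whole type [T] lets all vertex sets and both edge
    relations be compared without passing between subtypes. *)
Definition rel_within e X : rel T :=
  fun a b => [&& a \in X, b \in X & e a b].

Definition components_within e X : nat := n_comp (rel_within e X) (mem X).

Lemma rel_within_connect_sym e X :
  ssrbool.symmetric e -> connect_sym (rel_within e X).
Proof.
by move=> e_sym; apply: sym_connect_sym => a b; rewrite /rel_within e_sym andbCA.
Qed.

Lemma rel_within_closed e X :
  ssrbool.symmetric e -> closed (rel_within e X) (mem X).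
Proof. by move=> e_sym a b /and3P[Xa Xb _]; rewrite Xa Xb. Qed.

Lemma eq_components_within e f X :
  {in X &, e =2 f} -> components_within e X = components_within f X.
Proof.
move=> eq_ef; apply: eq_n_comp; apply: eq_connect => a b.
rewrite /rel_within; case Xa: (a \in X) => //=; case Xb: (b \in X) => //=.
exact: eq_ef.
Qed.

(** No edge inside [v |: Y] touches [v], so both counts concern the same relation and differ only by
    the root [v]. *)
Lemma components_within_isolated e v Y :
    ssrbool.symmetric e -> irreflexive e -> v \notin Y ->
    (forall u, u \in Y -> ~~ e v u) ->
  components_within e (v |: Y) = (components_within e Y).+1.
Proof.
move=> e_sym e_irr vY isol.
have eq_within : rel_within e (v |: Y) =2 rel_within e Y.
  move=> a b; rewrite /rel_within !inE.
  have [->|_] := eqVneq a v; have [->|_] := eqVneq b v => //=.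
  - by rewrite e_irr !andbF.
  - by rewrite (negPf vY) /=; apply/negP => /andP[/isol/negP].
  - rewrite (negPf vY) andbF; apply/negP => /andP[/isol/negP].
    by rewrite e_sym.
(* A nonempty path from [v] would begin with an edge inside [Y], forcing [v] into [Y]. *)
have root_v : fingraph.root (rel_within e Y) v = v.
  have := connect_root (rel_within e Y) v.
  case/connectP => -[|b p] //= /andP[/and3P[vY' _ _] _] _.
  by rewrite vY' in vY.
rewrite /components_within (eq_n_comp (eq_connect eq_within)).
rewrite /n_comp_mem (cardD1 v) !inE eqxx andbT /roots /= root_v eqxx.
congr (_.+1); apply: eq_card => u; rewrite !inE.
by have [->|_] := eqVneq u v; rewrite ?(negPf vY) ?andbF.
Qed.

(** Both counts are transferred, by adjunctions along the same inclusion [h], to one relation [t] on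
    the subtype of [Y]. *)
Lemma components_within_contract e f v w Y :
    ssrbool.symmetric e -> ssrbool.symmetric f -> v \notin Y ->
    w \in Y -> e v w ->
    {in Y &, forall a b, f a b = e a b || [&& a != b, e v a & e v b]} ->
  components_within e (v |: Y) = components_within f Y.
Proof.
move=> e_sym f_sym vY wY evw fE.
set r := rel_within e (v |: Y); set s := rel_within f Y.
have r_sym : connect_sym r by apply: rel_within_connect_sym.
have s_sym : connect_sym s by apply: rel_within_connect_sym.
have sub_sr a b : connect s a b -> connect r a b.
  apply: connect_sub => {}a {}b /and3P[aY bY]; rewrite fE //.
  case/orP => [eab|/and3P[_ eva evb]].
    by apply: connect1; rewrite /r /rel_within !inE aY bY eab !orbT.
  apply: (@connect_trans _ _ v); apply: connect1.
    by rewrite /r /rel_within !inE eqxx aY e_sym eva orbT.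
  by rewrite /r /rel_within !inE eqxx bY evb orbT.
(* Replacing [v] by its neighbour [w] turns a path of [r] into one of [s]: under [f], every other
   neighbour of [v] in [Y] is adjacent to [w]. *)
pose rep a := if a == v then w else a.
have s_nbr a : a \in Y -> e v a -> connect s w a.
  move=> aY eva; have [->|wa] := eqVneq w a; first exact: connect0.
  by apply: connect1; rewrite /s /rel_within wY aY fE // wa evw eva orbT.
have sub_rs a b : connect r a b -> connect s (rep a) (rep b).
  case/connectP => p; elim: p a => [|c p IHp] a /=; first by move=> _ ->; exact: connect0.
  case/andP=> /and3P[aX cX eac] /IHp{}IHp /IHp; apply: connect_trans.
  rewrite /rep; move: aX cX eac; rewrite !inE.
  have [->|_] := eqVneq a v; have [->|_] := eqVneq c v => //=.
  - by move=> _ cY; apply: s_nbr.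
  - by move=> aY _; rewrite s_sym e_sym; apply: s_nbr.
  - by move=> aY cY eac; apply: connect1; rewrite /s /rel_within aY cY fE ?eac.
pose h (a : {u | u \in Y}) := val a.
have h_neq a : h a != v by apply: contraNneq vY => <-; exact: (valP a).
pose t : rel {u | u \in Y} := relpre h s.
have t_sym : connect_sym t.
  by apply: sym_connect_sym => a b; rewrite /t /= /s /rel_within f_sym andbCA.
have adj_s : rel_adjunction h s t (mem Y).
  apply: (strict_adjunction t_sym); first exact: rel_within_closed.
  - exact: val_inj.
  - by apply/subsetP => a aY; apply/codomP; exists (exist _ a aY).
  - by move=> a b.
(* This adjunction is not strict: [v] is outside the image of [h] and is only connected to the image
   point [w]. *)
have adj_r : rel_adjunction h r t (mem (v |: Y)).
  split=> [a|a b _].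
    rewrite !inE; have [->|_] /= := eqVneq a v => aY.
      by exists (exist _ w wY); apply: connect1; rewrite /r /rel_within !inE eqxx wY evw orbT.
    by exists (exist _ a aY); exact: connect0.
  case: adj_s => _ /(_ a b (valP a)) ->.
  apply/idP/idP => [|/sub_rs]; first exact: sub_sr.
  by rewrite /rep !(negPf (h_neq _)).
rewrite /components_within.
rewrite (adjunction_n_comp _ r_sym t_sym _ adj_r); last exact: rel_within_closed.
rewrite (adjunction_n_comp _ s_sym t_sym _ adj_s); last exact: rel_within_closed.
apply: eq_n_comp_r => a; rewrite !inE.
by have := valP a => /= aY; rewrite [h a \in Y]aY orbT.
Qed.

(** Taking images under [val] is a bijection onto the subsets of [S], with preimage under [val] as
    inverse. *)
Lemma sum_subsets (R : nmodType) (S : {set T}) (F : {set T} -> R) :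
  \sum_(Z : {set {u | u \in S}}) F (val @: Z) = \sum_(X : {set T} | X \subset S) F X.
Proof.
rewrite [RHS](reindex (fun Z : {set {u | u \in S}} => val @: Z)).
  apply: eq_bigl => Z; apply/esym/subsetP => _ /imsetP[u _ ->]; exact: valP.
exists (fun X : {set T} => [set u | val u \in X]) => [Z _|X XS].
  by apply/setP => u; rewrite inE mem_imset //; exact: val_inj.
apply/setP => a; apply/imsetP/idP => [[u]|aX]; first by rewrite inE => ? ->.
by exists (exist _ a (subsetP XS a aX)); rewrite ?inE.
Qed.

Lemma sum_sets_split (R : nmodType) (v : T) (F : {set T} -> R) :
  \sum_(X : {set T}) F X = \sum_(X : {set T} | X \subset ~: [set v]) (F X + F (v |: X)).
Proof.
have sub_compl X : (X \subset ~: [set v]) = (v \notin X).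
  by rewrite subsetC sub1set inE.
rewrite big_split /= (bigID (fun X : {set T} => X \subset ~: [set v])) /=.
congr (_ + _); rewrite (reindex_onto (fun X => v |: X) (fun X => X :\ v)) /=.
  apply: eq_bigl => X; rewrite !sub_compl !inE eqxx /=.
  apply/eqP/idP => [<-|vX]; first by rewrite !inE eqxx.
  by rewrite setU1K.
by move=> X; rewrite sub_compl negbK; exact: setD1K.
Qed.

Lemma num_components_induced e (H : sgraph)
    (h : H -> T) (Z : {set H}) :
    ssrbool.symmetric e -> injective h ->
    (forall a b : H, sedge a b = e (h a) (h b)) ->
  num_components (induced Z) = components_within e (h @: Z).
Proof.
move=> e_sym h_inj hE.
pose k (a : induced Z) := h (val a).
have k_in a : k a \in h @: Z by apply: imset_f; exact: (valP a).
have edge_sym : connect_sym (@sedge (induced Z)).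
  by apply: sym_connect_sym; exact: sedge_sym.
have adj : rel_adjunction k (rel_within e (h @: Z)) (@sedge (induced Z)) (mem (h @: Z)).
  apply: (strict_adjunction edge_sym); first exact: rel_within_closed.
  - by move=> a b /h_inj/val_inj.
  - apply/subsetP => _ /imsetP[a aZ ->]; apply/codomP.
    by exists (exist _ a aZ).
  - by move=> a b _; rewrite /rel_within !k_in /= /induced_edge hE.
rewrite /components_within /num_components.
rewrite (adjunction_n_comp _ _ _ _ adj).
- by apply: eq_n_comp_r => a; rewrite !inE k_in.
- exact: rel_within_connect_sym.
- exact: edge_sym.
- exact: rel_within_closed.
Qed.

(** Leaving [f] general covers both vertex removal and contraction, so that all polynomials become
    sums over subsets of one type. *)
Lemma subgraph_component_poly_sub e (S : {set T})
    (f : rel {u | u \in S}) (f_sym : ssrbool.symmetric f) (f_irr : irreflexive f) :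
    ssrbool.symmetric e -> (forall a b, f a b = e (val a) (val b)) ->
  subgraph_component_poly (SGraph f_sym f_irr) =
    \sum_(X : {set T} | X \subset S) xvar ^+ #|X| * yvar ^+ components_within e X.
Proof.
move=> e_sym fE; rewrite -sum_subsets; apply: eq_bigr => Z _.
rewrite card_imset; last exact: val_inj.
by rewrite (num_components_induced (e := e) (H := SGraph f_sym f_irr) (h := val)) //; exact: val_inj.
Qed.

End ComponentsWithin.

Theorem theorem5p2 (G : sgraph) (v : G) :
  subgraph_component_poly G =
    subgraph_component_poly (remove_vertex v)
    + xvar * (yvar - 1) *
        subgraph_component_poly (remove_vertices (closed_nbhd v))
    + xvar * subgraph_component_poly (contract_vertex v).
Proof.
pose e := @sedge G.
(* The contracted edge relation, extended to all of [G] including [v]. *)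
pose c : rel G := fun a b => e a b || [&& a != b, e v a & e v b].
have e_sym : ssrbool.symmetric e by exact: sedge_sym.
have c_sym : ssrbool.symmetric c.
  by move=> a b; rewrite /c e_sym eq_sym [e v a && _]andbC.
rewrite (subgraph_component_poly_sub (e := e)) // (subgraph_component_poly_sub (e := e)) //.
rewrite (subgraph_component_poly_sub (e := c)) //.
have -> : subgraph_component_poly G =
    \sum_(X : {set G}) xvar ^+ #|X| * yvar ^+ components_within e X.
  apply: eq_bigr => X _.
  by rewrite (num_components_induced (e := e) (h := id)) // imset_id.
rewrite (sum_sets_split v) big_split /= -addrA; congr (_ + _).
rewrite !mulr_sumr.
(* Padding the correction sum with zeros gives all sums the same index set, so they can be compared
   term by term. *)
have -> : \sum_(X : {set G} | X \subset ~: closed_nbhd v)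
      xvar * (yvar - 1) * (xvar ^+ #|X| * yvar ^+ components_within e X) =
    \sum_(X : {set G} | X \subset ~: [set v])
      if X \subset ~: closed_nbhd v then
        xvar * (yvar - 1) * (xvar ^+ #|X| * yvar ^+ components_within e X) else 0.
  rewrite -big_mkcondr; apply: eq_bigl => X; rewrite andb_idl // => /subset_trans; apply.
  by rewrite setCS subsetUl.
rewrite -big_split; apply: eq_bigr => Y /=; rewrite subsetC sub1set inE => vY.
rewrite cardsU1 vY add1n exprS.
case: ifPn => [/subsetP Y_far|/subsetPn[w wY]].
  have isol u : u \in Y -> ~~ e v u by move=> /Y_far; rewrite !inE negb_or => /andP[].
  rewrite components_within_isolated //; last exact: sedge_irrefl.
  rewrite (@eq_components_within _ c e) => [|a b aY bY].
    by rewrite exprS; ring.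
  by rewrite /c (negPf (isol a aY)) /= andbF orbF.
(* Here [Y] meets the closed neighbourhood at [w], which is a true neighbour since [v] is not in
   [Y]; the correction term is 0. *)
rewrite !inE negbK => /orP[/eqP wv|evw]; first by rewrite -wv wY in vY.
by rewrite (components_within_contract (f := c) (w := w)) // add0r mulrA.
Qed.
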